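(* Let $h\in C(Z\times E)$ be an integrand with linear growth at infinity. Then $$(h^\#)_{\mathcal A\text{-}\mathrm{hom}}(z)\ \ge\ (h_{\mathcal A\text{-}\mathrm{hom}})^\#(z)\qquad\text{for all }z\in E.$$
   Context: $Z=\mathbb T^d=\mathbb R^d/\mathbb Z^d$; $E,F$ are finite-dimensional Euclidean spaces. $\mathcal A=\sum_{|\alpha|=k}A_\alpha\partial^\alpha$, $A_\alpha\in\mathrm{Lin}(E;F)$, is a homogeneous constant-coefficient linear partial differential operator of order $k$ on $\mathbb R^d$. Linear growth at infinity: $|h(\xi,z)|\le M(1+|z|)$ for some $M>0$. Upper recession function: $h^\#(\xi,z)=\limsup_{\xi'\to\xi,\ t\to\infty}\frac{h(\xi',tz)}{t}$; for a function $g$ of $z$ only, $g^\#(z)=\limsup_{t\to\infty}\frac{g(tz)}t$. $\mathcal A$-free homogeneous envelope of an integrand $h:Z\times E\to\mathbb R$ (regarded as periodic in the first variable): $$h_{\mathcal A\text{-}\mathrm{hom}}(z)=\inf\Big\{\frac1{R^d}\int_{Q_R}h(y,z+w(y))\,dy\ :\ R\in\mathbb N,\ w\in C^\infty_{\mathrm{per}}(Q_R;E)\cap\ker\mathcal A,\ \int_{Q_R}w\,dy=0\Big\},$$ where $Q_R$ is a cube of side length $R$ with sides parallel to the axes and $C^\infty_{\mathrm{per}}(Q_R;E)$ are the smooth $Q_R$-periodic maps $\mathbb R^d\to E$; the same formula is used for $h^\#$ in place of $h$. Values $-\infty$ are allowed. *)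

(* Defs.v *)
From HB Require Import structures.
From mathcomp Require Import all_boot all_order all_algebra generic_quotient.
From mathcomp Require Import all_classical all_reals all_analysis.

Set Implicit Arguments.
Unset Strict Implicit.
Unset Printing Implicit Defensive.

Import Order.TTheory GRing.Theory Num.Theory.
Import numFieldNormedType.Exports.

Local Open Scope classical_set_scope.
Local Open Scope ring_scope.

Section torus.
Variables (R : realType) (d : nat).
Implicit Types x y : 'rV[R]_d.

Definition congZ x y : bool := [forall i, (x - y) 0 i \is a Num.int].

Lemma congZ_refl : reflexive congZ.
Proof. by move=> x; apply/forallP => i; rewrite subrr mxE rpred0. Qed.

Lemma congZ_sym : symmetric congZ.
Proof.
by move=> x y; apply: eq_forallb => i; rewrite -opprB mxE rpredN.
Qed.

Lemma congZ_trans : transitive congZ.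
Proof.
move=> y x z /forallP xy /forallP yz; apply/forallP => i.
by rewrite -(subrK y x) -addrA mxE rpredD.
Qed.

Canonical congZ_equiv := EquivRel congZ congZ_refl congZ_sym congZ_trans.

Definition torus : Type := quotient_topology {eq_quot congZ_equiv}%qT.
HB.instance Definition _ := Topological.on torus.

Definition toTorus x : torus := (\pi_({eq_quot congZ_equiv}) x)%qT.

End torus.

(* R^n is modelled here by n.-tuple R, whose product sigma-algebra is the
   Borel one. *)
Section lebesgue_measure_tuple.
Variable R : realType.
Local Notation mR := (measurableTypeR R).

Definition cons_pair n (p : mR * n.-tuple mR) : n.+1.-tuple mR :=
  [tuple of p.1 :: p.2].

Fixpoint lebesgue_tuple (n : nat) : set (n.-tuple mR) -> \bar R :=
  match n return set (n.-tuple mR) -> \bar R with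
  | 0%N => dirac ([tuple] : 0.-tuple mR)
  | n'.+1 => pushforward (lebesgue_measure \x @lebesgue_tuple n')%E
               (@cons_pair n')
  end.

Lemma measurable_cons_pair n : measurable_fun setT (@cons_pair n).
Proof. exact: measurable_cons. Qed.

Lemma lebesgue_tuple_bundle n :
  {m : {sigma_finite_measure set (n.-tuple mR) -> \bar R} |
     m = @lebesgue_tuple n :> (set (n.-tuple mR) -> \bar R)}.
Proof.
elim: n => [|n [m mE]] /=.
  by exists (dirac ([tuple] : 0.-tuple mR)).
rewrite -mE.
pose P : {measure set (mR * n.-tuple mR)%type -> \bar R} :=
  (@lebesgue_measure R \x m)%E.
pose M : {measure set (n.+1.-tuple mR) -> \bar R} :=
  measure_function_pushforward__canonical__measure_function_Measure P
    (@measurable_cons_pair n).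
have sf : sigma_finite setT M.
  pose uncons (t : n.+1.-tuple mR) : mR * n.-tuple mR :=
    (thead t, [tuple of behead t]).
  have muncons : measurable_fun setT uncons.
    apply/measurable_fun_pair; [exact: measurable_tnth|exact: measurable_behead].
  have consK A : @cons_pair n @^-1` (uncons @^-1` A) = A.
    rewrite -comp_preimage (_ : _ \o _ = id) ?preimage_id//.
    by apply/funext => -[x t]; rewrite /uncons/=; congr pair; exact/val_inj.
  have /sigma_finiteP[F [TF ndF Foo]] := sigma_finiteT (@lebesgue_measure R).
  have /sigma_finiteP[G [TG ndG Goo]] := sigma_finiteT m.
  exists (fun i => uncons @^-1` (F i `*` G i)).
    rewrite -preimage_bigcup (_ : bigcup _ _ = setT) ?preimage_setT//.
    rewrite -setXTT TF TG predeqE => -[x y]; split.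
      by move=> [k _ []/= ? ?]; split; exists k.
    move=> [/= [k _ Fkx] [l _ Gly]]; exists (maxn k l) => //; split.
    - by move: x Fkx; exact/subsetPset/ndF/leq_maxl.
    - by move: y Gly; exact/subsetPset/ndG/leq_maxr.
  move=> k; have [mF Fk] := Foo k; have [mG Gk] := Goo k; split.
    by rewrite -[X in measurable X]setTI; apply: muncons => //; exact: measurableX.
  rewrite /M/= /pushforward consK.
  by rewrite product_measure1E// lte_mul_pinfty// ge0_fin_numE.
pose S := Measure_isSigmaFinite.Build _ _ _ M sf.
pose MS : {sigma_finite_measure set (n.+1.-tuple mR) -> \bar R} :=
  HB.pack (M : set (n.+1.-tuple mR) -> \bar R) (Measure.on M) S.
by exists MS.
Qed.

Lemma lebesgue_tuple0 n : @lebesgue_tuple n set0 = 0%E.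
Proof. by have [m <-] := lebesgue_tuple_bundle n; exact: measure0. Qed.

Lemma lebesgue_tuple_ge0 n A : (0 <= @lebesgue_tuple n A)%E.
Proof. by have [m <-] := lebesgue_tuple_bundle n; exact: measure_ge0. Qed.

Lemma lebesgue_tuple_sigma_additive n : semi_sigma_additive (@lebesgue_tuple n).
Proof.
have [m <-] := lebesgue_tuple_bundle n; exact: measure_semi_sigma_additive.
Qed.

HB.instance Definition _ n := isMeasure.Build _ _ _ (@lebesgue_tuple n)
  (@lebesgue_tuple0 n) (@lebesgue_tuple_ge0 n)
  (@lebesgue_tuple_sigma_additive n).

Lemma lebesgue_tuple_sigma_finite n : sigma_finite setT (@lebesgue_tuple n).
Proof. by have [m <-] := lebesgue_tuple_bundle n; exact: sigma_finiteT. Qed.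

HB.instance Definition _ n := Measure_isSigmaFinite.Build _ _ _
  (@lebesgue_tuple n) (@lebesgue_tuple_sigma_finite n).

End lebesgue_measure_tuple.

Section smooth.
Variables (R : realType) (d m : nat).
Implicit Types w : 'rV[R]_d -> 'rV[R]_m.

Definition partial (i : 'I_d) w : 'rV[R]_d -> 'rV[R]_m :=
  fun x => 'D_(delta_mx 0 i) w x.

Fixpoint Ck (k : nat) w : Prop :=
  continuous w /\
  if k is k'.+1 then
    (forall i x, derivable w x (delta_mx 0 i)) /\
    (forall i, Ck k' (partial i w))
  else True.

Definition smooth w : Prop := forall k, Ck k w.

Definition partial_multi k (alpha : {ffun 'I_d -> 'I_k.+1}) w :=
  foldr (fun i f => iter (alpha i) (partial i) f) w (enum 'I_d).

Definition periodic (N : nat) w : Prop :=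
  forall x (v : 'rV[int]_d), w (x + N%:R *: map_mx intr v) = w x.

End smooth.

(* The coefficients are indexed by all alpha with entries at most k; only
   those with |alpha| = k enter the operator. *)
Definition pdo (R : realType) (d m n k : nat)
    (A : {ffun 'I_d -> 'I_k.+1} -> {linear 'rV[R]_m -> 'rV[R]_n})
    (w : 'rV[R]_d -> 'rV[R]_m) : 'rV[R]_d -> 'rV[R]_n :=
  fun x => \sum_(alpha : {ffun 'I_d -> 'I_k.+1} | (\sum_i alpha i == k)%N)
             A alpha (partial_multi alpha w x).

Section envelope.
Variables (R : realType) (d m : nat).
Local Notation mR := (measurableTypeR R).
Implicit Types h : torus R d -> 'rV[R]_m -> \bar R.

Definition euclidean_norm (z : 'rV[R]_m) : R := Num.sqrt (\sum_i z 0 i ^+ 2).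

Definition linear_growth (h : torus R d -> 'rV[R]_m -> R) : Prop :=
  exists2 M : R, 0 < M & forall xi z, `|h xi z| <= M * (1 + euclidean_norm z).

Definition row_of_tuple (y : d.-tuple mR) : 'rV[R]_d := \row_i tnth y i.

Definition cube (N : nat) : set (d.-tuple mR) :=
  [set y | forall i, tnth y i \in `[0, N%:R]%R].

Definition recession2 h (xi : torus R d) (z : 'rV[R]_m) : \bar R :=
  limf_esup (fun p : torus R d * R => h p.1 (p.2 *: z) * (p.2^-1)%:E)%E
    (filter_prod (nbhs xi) (pinfty_nbhs R)).

Definition recession (g : 'rV[R]_m -> \bar R) (z : 'rV[R]_m) : \bar R :=
  limf_esup (fun t : R => g (t *: z) * (t^-1)%:E)%E (pinfty_nbhs R).

Definition A_free_hom (n k : nat)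
    (A : {ffun 'I_d -> 'I_k.+1} -> {linear 'rV[R]_m -> 'rV[R]_n})
    h (z : 'rV[R]_m) : \bar R :=
  ereal_inf [set r | exists (N : nat) (w : 'rV[R]_d -> 'rV[R]_m),
    [/\ (0 < N)%N,
        smooth w /\ periodic N w,
        forall x, pdo A w x = 0,
        forall j, (\int[@lebesgue_tuple R d]_(y in cube N)
                     (w (row_of_tuple y) 0 j)%:E = 0)%E &
        r = (((N%:R ^+ d)^-1)%:E *
             \int[@lebesgue_tuple R d]_(y in cube N)
               h (toTorus (row_of_tuple y))
                 (z + w (row_of_tuple y))%R)%E ]].

End envelope.

(* Main.v *)
(* If w is a competitor for the envelope of h^# at z, then t w is one for the
   envelope of h at t z, so h_{A-hom}(t z) / t is at most the mean of
   h(y, t (z + w(y))) / t. By linear growth and boundedness of z + w these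
   integrands are uniformly bounded for t >= 1, so the reverse Fatou lemma along
   a sequence t_n -> oo, together with
   limsup_n h(y, t_n u) / t_n <= h^#(y, u), bounds the limsup of the means by
   the mean of h^#(y, z + w(y)). *)

Require Import Defs.
From mathcomp Require Import all_boot all_order all_algebra.
From mathcomp Require Import all_classical all_reals all_analysis.
From mathcomp Require Import measurable_realfun.
Set Implicit Arguments.
Unset Strict Implicit.
Unset Printing Implicit Defensive.

Import numFieldNormedType.Exports.
Import Order.TTheory GRing.Theory Num.Theory.
Local Open Scope classical_set_scope.
Local Open Scope ring_scope.

(** * Scaling of competitors, and the Euclidean norm *)

Section scaling.
Context {R : realType} {d m : nat}.
Implicit Types (w : 'rV[R]_d -> 'rV[R]_m) (t : R).

Lemma partialZ t i w : (forall x, derivable w x (delta_mx 0 i)) ->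
  partial i (t \*: w) = t \*: partial i w.
Proof. by move=> dw; apply/funext => x; exact/deriveZ/dw. Qed.

Lemma CkZ t k w : Ck k w -> Ck k (t \*: w).
Proof.
elim: k w => [|k IHk] w /= [cw dw].
  by split=> // x; exact/continuousZl_tmp/cw.
split; first by move=> x; exact/continuousZl_tmp/cw.
case: dw => dw Ckw; split=> i => [x|]; first exact/derivableZ/dw.
by rewrite partialZ//; exact: IHk.
Qed.

Lemma smoothZ t w : smooth w -> smooth (t \*: w).
Proof. by move=> sw k; exact/CkZ/sw. Qed.

Lemma smooth_continuous w : smooth w -> continuous w.
Proof. by case/(_ 0%N). Qed.

Lemma smooth_derivable w i x : smooth w -> derivable w x (delta_mx 0 i).
Proof. by case/(_ 1%N) => _ [+ _]; exact. Qed.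

Lemma smooth_partial i w : smooth w -> smooth (partial i w).
Proof. by move=> sw k; have [_ [_]] := sw k.+1; exact. Qed.

Lemma smooth_partial_iter i j w : smooth w -> smooth (iter j (partial i) w).
Proof. by move=> sw; elim: j => //= j; exact: smooth_partial. Qed.

Lemma partial_iterZ t i j w : smooth w ->
  iter j (partial i) (t \*: w) = t \*: iter j (partial i) w.
Proof.
move=> sw; elim: j => //= j ->; rewrite partialZ// => x.
exact/smooth_derivable/smooth_partial_iter.
Qed.

Lemma partial_multiZ t k (alpha : {ffun 'I_d -> 'I_k.+1}) w : smooth w ->
  partial_multi alpha (t \*: w) = t \*: partial_multi alpha w.
Proof.
move=> sw; rewrite /partial_multi.
(* Smoothness of the fold is carried through the induction, since commuting the next derivatives
   with [t] requires it. *)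
suff [] : smooth (foldr (fun i f => iter (alpha i) (partial i) f) w (enum 'I_d))
  /\ foldr (fun i f => iter (alpha i) (partial i) f) (t \*: w) (enum 'I_d) =
    t \*: foldr (fun i f => iter (alpha i) (partial i) f) w (enum 'I_d) by [].
elim: (enum _) => //= i s [sf ->]; split; first exact: smooth_partial_iter.
exact: partial_iterZ.
Qed.

Lemma pdoZ n k (A : {ffun 'I_d -> 'I_k.+1} -> {linear 'rV[R]_m -> 'rV[R]_n})
  t w : smooth w -> pdo A (t \*: w) = t \*: pdo A w.
Proof.
move=> sw; apply/funext => x; rewrite /pdo /= scaler_sumr.
by apply: eq_bigr => alpha _; rewrite partial_multiZ//= linearZ.
Qed.

Lemma periodicZ N t w : Defs.periodic N w -> Defs.periodic N (t \*: w).
Proof. by move=> pw x v; rewrite /= pw. Qed.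

Lemma euclidean_normZ t (z : 'rV[R]_m) :
  euclidean_norm (t *: z) = `|t| * euclidean_norm z.
Proof.
rewrite /euclidean_norm -sqrtr_sqr -sqrtrM ?sqr_ge0// mulr_sumr.
by congr Num.sqrt; apply: eq_bigr => i _; rewrite mxE exprMn.
Qed.

Lemma le_mx_norm (z : 'rV[R]_m) i : `|z 0 i| <= `|z|.
Proof.
rewrite [leRHS]/Num.norm/= mx_normrE.
by apply: le_trans (le_bigmax _ _ (0, i)).
Qed.

(** Links [bounded_set], which refers to the sup norm of row vectors, to the norm in the growth
    condition: coordinates bounded by C give the bound sqrt(m C^2). *)
Lemma euclidean_norm_bounded (S : set 'rV[R]_m) :
  bounded_set S -> exists2 C, 0 <= C & forall z, S z -> euclidean_norm z <= C.
Proof.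
move=> [B [_ /(_ (B + 1))]]; rewrite ltrDl => /(_ ltr01); set C := B + 1 => SC.
exists (Num.sqrt (\sum_(i < m) C ^+ 2)); first exact: sqrtr_ge0.
move=> z /SC zC; rewrite ler_wsqrtr//; apply: ler_sum => i _.
rewrite -real_normK ?num_real// ler_sqr ?nnegrE//.
  exact: le_trans (le_mx_norm _ _) zC.
exact: le_trans zC.
Qed.

End scaling.

(** * Monotonicity of integrals and the reverse Fatou lemma *)

(* Measurability is not needed because the integral is a difference of suprema
   over simple functions; this spares showing that the recession function of
   the integrand is measurable. *)
Lemma le_integral_nonmeasurable d (T : measurableType d) (R : realType)
    (mu : {measure set T -> \bar R}) (D : set T) (f g : T -> \bar R) :
  (forall x, D x -> f x <= g x)%E ->
  (\int[mu]_(x in D) f x <= \int[mu]_(x in D) g x)%E.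
Proof.
move=> fg; have fgD x : ((f \_ D) x <= (g \_ D) x)%E.
  by rewrite !patchE; case: ifPn => // /set_mem/fg.
rewrite /integral; apply: leeB; apply: ereal_sup_le => _ [h hf <-];
  exists h => // x; apply: (le_trans (hf x)).
  by rewrite !funeposE; exact: le_max2.
by rewrite !funenegE; apply: le_max2 => //; rewrite leeN2.
Qed.

Lemma lee_absl (R : realDomainType) (x y : \bar R) :
  (`|x| <= y)%E = (- y <= x <= y)%E.
Proof.
by move: x y => [x| |] [y| |] //=; rewrite ?lee_fin ?leey ?leNye// ler_norml.
Qed.

(* Reverse Fatou, by dominated convergence of the suprema of tails. *)
Lemma le_integral_limn_esup d (T : measurableType d) (R : realType)
    (mu : {measure set T -> \bar R}) (D : set T) (f_ : (T -> \bar R)^nat)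
    (g : T -> \bar R) (c : \bar R) :
  measurable D -> (forall n, measurable_fun D (f_ n)) -> mu.-integrable D g ->
  (forall n x, D x -> `|f_ n x| <= g x)%E ->
  (forall n, c <= \int[mu]_(x in D) f_ n x)%E ->
  (c <= \int[mu]_(x in D) limn_esup (f_ ^~ x))%E.
Proof.
move=> mD mf ig fg cf.
have [] := @dominated_convergence _ _ _ mu D mD
  (fun n x => esups (f_ ^~ x) n) (fun x => limn_esup (f_ ^~ x)) g.
- by move=> n; exact: measurable_fun_esups.
- exact: measurable_fun_limn_esup.
- by apply/aeW => x _; rewrite limn_esup_lim; exact: is_cvg_esups.
- exact: ig.
(* The n-th tail supremum is at least f_n >= -g, and at most g because every f_k is. *)
- apply/aeW => x n Dx; rewrite lee_absl; apply/andP; split.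
    apply: (@le_trans _ _ (f_ n x)).
      by have := fg n x Dx; rewrite lee_absl => /andP[].
    by apply: ereal_sup_ubound; exists n => /=.
  apply: ge_ereal_sup => _ [k _ <-].
  exact: le_trans (lee_abs _) (fg k x Dx).
move=> _ _ cvgI; rewrite -(cvg_lim _ cvgI)//; apply: lime_ge.
  by apply/cvg_ex; eexists; exact: cvgI.
apply: nearW => n; apply: (le_trans (cf n)).
apply: le_integral_nonmeasurable => x Dx.
by apply: ereal_sup_ubound; exists n => /=.
Qed.

(** * Measurability, boundedness and integrability on cubes *)

Section cube.
Context {R : realType} {d : nat}.
Local Notation mR := (measurableTypeR R).

Lemma measurable_box n (B : 'I_n -> set mR) : (forall i, measurable (B i)) ->
  measurable [set y : n.-tuple mR | forall i, B i (tnth y i)].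
Proof.
move=> mB; rewrite (_ : mkset _ = \bigcap_(i in [set: 'I_n])
    ((fun y : n.-tuple mR => tnth y i) @^-1` B i)); last first.
  by apply/seteqP; split => y /= By i; [move=> _|]; exact: (By i).
apply: fin_bigcap_measurable => [|i _]; first exact: finite_finset.
by rewrite -[X in measurable X]setTI; exact: measurable_tnth.
Qed.

Lemma measurable_cube N : measurable (@cube R d N).
Proof. by apply: (@measurable_box d (fun=> `[0, N%:R]%classic)) => i. Qed.

(* An open set is the countable union of the balls with rational centre and
   radius that it contains. *)
Lemma measurable_row_of_tuple_preimage (U : set 'rV[R]_d) : open U ->
  measurable (@row_of_tuple R d @^-1` U).
Proof.
move=> oU.
pose c (p : 'rV[rat]_d * rat) : set 'rV[R]_d :=
  ball (map_mx ratr p.1 : 'rV[R]_d) (ratr p.2 : R).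
pose F p := if `[< c p `<=` U >] then @row_of_tuple R d @^-1` c p else set0.
rewrite (_ : _ @^-1` U = \bigcup_p F p); last first.
  apply/seteqP; split => y /=; last first.
    by move=> [p _]; rewrite /F; case: ifPn => // /asboolP cU /cU.
  set x := row_of_tuple y => Ux.
  have /nbhs_ballP[e /= e0 eU] : nbhs x U by exact: open_nbhs_nbhs.
  (* With a radius below e/2, a ball that contains x lies in the ball of radius e around x. *)
  have [r] := rat_in_itvoo (divr_gt0 e0 (ltr0Sn R 1)).
  rewrite in_itv/= => /andP[r0 re].
  have /choice[q xq] (i : 'I_d) :
      exists q : rat, ratr q \in `]x 0 i - ratr r, x 0 i + ratr r[.
    by apply: rat_in_itvoo; rewrite ltrD2l (lt_trans _ r0)// oppr_lt0.
  have xc : ball (map_mx ratr (\row_i q i) : 'rV[R]_d) (ratr r : R) x.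
    split => // i j; rewrite ord1 !mxE -ball_normE/=.
    by have := xq j; rewrite in_itv/= !mxE -ltr_distl.
  exists (\row_i q i, r) => //; rewrite /F ifT//; apply/asboolP.
  move=> u cu; apply: eU.
  exact: ball_splitr (le_ball (ltW re) xc) (le_ball (ltW re) cu).
apply: countable_bigcupT_measurable => [|p]; first exact: countableP.
rewrite /F; case: ifPn => // _.
(* A ball of row vectors demands a positive radius besides the coordinatewise condition, so it is
   empty for radius <= 0, even if d = 0; otherwise it is a box. *)
have [r0|r0] := ltP 0 (ratr p.2 : R); last first.
  rewrite (_ : _ @^-1` _ = set0)// -subset0 => y [/= /lt_le_trans/(_ r0)].
  by rewrite ltxx.
rewrite (_ : _ @^-1` _ =
    [set y | forall i, ball (ratr (p.1 0 i) : R) (ratr p.2) (tnth y i)]);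
  last first.
  apply/seteqP; split => y /= => [[_ By] i|By].
    by have := By 0 i; rewrite !mxE.
  by split => // i j; rewrite ord1 !mxE.
apply: (@measurable_box d (fun i => ball (ratr (p.1 0 i) : R) (ratr p.2))) => i.
exact: measurable_ball.
Qed.

(** Topology lives on row vectors and measure on tuples; open intervals generate the Borel sets, and
    their preimages under f are open. *)
Lemma continuous_measurable_row_of_tuple (f : 'rV[R]_d -> R) D :
  continuous f -> measurable_fun D (f \o @row_of_tuple R d).
Proof.
move=> /continuousP cf; apply: measurable_funTS.
apply: (measurability _ (RGenOpens.measurableE R)).
move=> _ [_ [a [b ->] <-]]; rewrite setTI comp_preimage.
apply: measurable_row_of_tuple_preimage; apply: cf.
exact: (@interval_open R (BRight a) (BLeft b)).
Qed.

Lemma bounded_image_cube (T : normedModType R) (f : 'rV[R]_d -> T) N :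
  continuous f -> bounded_set [set f (row_of_tuple y) | y in @cube R d N].
Proof.
move=> cf.
(* Compactness is stated for the box of row vectors, a product of segments. *)
have : compact [set v : 'rV[R]_d | forall i, `[0, N%:R]%classic (v ord0 i)].
  by apply: (@rV_compact R d (fun=> `[0, N%:R]%classic)) => i;
    exact: segment_compact.
move=> /(continuous_compact (continuous_subspaceT cf))/compact_bounded.
move=> [B [Br fB]].
exists B; split=> // x /fB xB _ [y cy <-]; apply: xB.
exists (row_of_tuple y) => // i.
by rewrite mxE; exact: cy.
Qed.

End cube.

(** Induction on d: [cons_pair] pulls the cube back to a segment times a cube of one dimension
    less. *)
Lemma lebesgue_tuple_cube_fin (R : realType) d N :
  (lebesgue_tuple (@cube R d N) < +oo)%E.
Proof.
elim: d => [|d IHd] /=.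
  by rewrite diracE ltry.
rewrite /pushforward (_ : _ @^-1` _ = `[0, N%:R]%classic `*` @cube R d N);
  last first.
  apply/seteqP; split => -[x y] /= => [c|[x0 cy] i].
    split; first exact: (c ord0).
    by move=> i; have := c (lift ord0 i); rewrite tnthS.
  by case: (unliftP ord0 i) => [j|] ->;
    [rewrite tnthS; exact: cy|rewrite tnth0].
rewrite product_measure1E//; last exact: measurable_cube.
have NE : (@lebesgue_measure R `[0%R, N%:R]%classic = N%:R%:E)%E.
  rewrite lebesgue_measure_itv/= lte_fin ltr0n; case: posnP => [->//|_].
  by rewrite oppr0 adde0.
by apply: lte_mul_pinfty => //; rewrite [X in X \is a _]NE.
Qed.

Lemma continuous_cube_integrable (R : realType) d N (f : 'rV[R]_d -> R) :
  continuous f ->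
  (@lebesgue_tuple R d).-integrable (cube N) (EFin \o (f \o @row_of_tuple R d)).
Proof.
move=> cf; apply: measurable_bounded_integrable.
- exact: measurable_cube.
- exact: lebesgue_tuple_cube_fin.
- exact: continuous_measurable_row_of_tuple.
have [B [Br fB]] := @bounded_image_cube R d R f N cf.
by exists B; split => // x /fB xB y cy; apply: xB; exists y.
Qed.

(** * Upper limits along filters *)

Section limf_esup.
Context {R : realType}.

Lemma limf_esup_le_near (T : choiceType) (X : filteredType T)
    (f : X -> \bar R) (F : set_system X) (c : \bar R) :
  (\forall x \near F, (f x <= c)%E) -> (limf_esup f F <= c)%E.
Proof.
move=> fc; apply: (@le_trans _ _ (ereal_sup (f @` [set x | (f x <= c)%E]))).
  by apply: ereal_inf_lbound; exists [set x | (f x <= c)%E].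
by apply: ge_ereal_sup => _ [x fx <-].
Qed.

(** If g sends F to G, each V in G yields the set g^-1(V) in F, on which the supremum of f o g is no
    larger than that of f on V. *)
Lemma limf_esup_comp_le (T T' : choiceType) (X : filteredType T)
    (Y : filteredType T') (f : Y -> \bar R) (g : X -> Y)
    (F : set_system X) (G : set_system Y) :
  (forall V, G V -> F (g @^-1` V)) ->
  (limf_esup (f \o g) F <= limf_esup f G)%E.
Proof.
move=> FG; apply: le_ereal_inf_tmp => _ [V /FG gV <-].
apply: (@le_trans _ _ (ereal_sup ((f \o g) @` (g @^-1` V)))).
  by apply: ereal_inf_lbound; exists (g @^-1` V).
by apply: ge_ereal_sup => _ [x Vgx <-]; apply: ereal_sup_ubound; exists (g x).
Qed.

(** Replaces the usual epsilon of room, so as to cover x = -oo as well. *)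
Lemma lee_forall_gt (x y : \bar R) :
  (forall c, x < c -> y <= c)%E -> (y <= x)%E.
Proof.
case: x => [r|//|] h; last 1 first.
- by rewrite (@eq_ninfty _ y)// => r; apply: h; rewrite ltNyr.
- by apply/lee_addgt0Pr => e e0; apply: h; rewrite -EFinD lte_fin ltrDl.
- exact: leey.
Qed.

End limf_esup.

(** * Passing to the recession function under the integral *)

Section integrand.
Context {R : realType} {d m : nat}.
Variable h : torus R d -> 'rV[R]_m -> R.
Hypothesis h_cont : continuous (fun p : torus R d * 'rV[R]_m => h p.1 p.2).
Hypothesis h_growth : linear_growth h.

Lemma continuous_integrand (v : 'rV[R]_d -> 'rV[R]_m) : continuous v ->
  continuous (fun x => h (toTorus x) (v x)).
Proof.
move=> cv x.
apply: (@continuous_comp _ _ _ (fun x => (toTorus x, v x))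
  (fun p : torus R d * 'rV[R]_m => h p.1 p.2)); last exact: h_cont.
exact: (cvg_pair (@pi_continuous _ _ x) (cv x)).
Qed.

(** For t >= 1, M (1 + t |z|) / t <= M (1 + |z|), uniformly in [xi]; this supplies the dominating
    constant. *)
Lemma growth_bound (S : set 'rV[R]_m) : bounded_set S ->
  exists C, forall xi z t, S z -> 1 <= t -> `|h xi (t *: z) * t^-1| <= C.
Proof.
move=> /euclidean_norm_bounded[B B0 SB]; have [M M0 hM] := h_growth.
exists (M * (1 + B)) => xi z t /SB zB t1.
have t0 : 0 < t by exact: lt_le_trans t1.
rewrite normrM normfV (gtr0_norm t0) ler_pdivrMr//.
apply: (le_trans (hM _ _)); rewrite -mulrA ler_pM2l// euclidean_normZ.
rewrite (gtr0_norm t0) mulrDl mul1r lerD// mulrC.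
by rewrite ler_pM2r.
Qed.

(** The sequence (xi, t_n) converges along the product filter, as xi lies in each of its
    neighbourhoods. *)
Lemma limn_esup_le_recession2 (t_ : R^nat) xi z : t_ @ \oo --> +oo%R ->
  (limn_esup (fun n => ((h xi (t_ n *: z))%:E * ((t_ n)^-1)%:E)) <=
   recession2 (fun xi v => (h xi v)%:E) xi z)%E.
Proof.
move=> toy; apply: (@limf_esup_comp_le R _ _ _ _
  (fun p : torus R d * R => ((h p.1 (p.2 *: z))%:E * (p.2^-1)%:E)%E)
  (fun n => (xi, t_ n))) => V [[U W] [/= nU nW] UWV].
apply: (@filterS _ \oo _ (t_ @^-1` W)); last exact: toy.
by move=> n Wn; apply: UWV; split => //=; exact: nbhs_singleton.
Qed.

Lemma near_integral_le_recession2 N (v : 'rV[R]_d -> 'rV[R]_m) (c : \bar R) :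
  continuous v ->
  (\int[@lebesgue_tuple R d]_(y in cube N)
     recession2 (fun xi u => (h xi u)%:E) (toTorus (row_of_tuple y))
       (v (row_of_tuple y)) < c)%E ->
  \forall t \near +oo%R, (\int[@lebesgue_tuple R d]_(y in cube N)
     (h (toTorus (row_of_tuple y)) (t *: v (row_of_tuple y)) * t^-1)%:E <= c)%E.
Proof.
move=> cv Ic; apply: contrapT => nle.
(* If the claim fails, some t > n + 1 violates it for each n. The bound n + 1 gives both divergence
   and t_n >= 1. *)
have /choice[t_ /all_and2[t_gt t_int]] (n : nat) : exists t : R, n.+1%:R < t /\
    (c <= \int[@lebesgue_tuple R d]_(y in cube N)
     (h (toTorus (row_of_tuple y)) (t *: v (row_of_tuple y)) * t^-1)%:E)%E.
  apply: contrapT => /forallNP nt; apply: nle; exists n.+1%:R.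
  split; first exact: num_real.
  move=> t tn; rewrite leNgt; apply/negP => ct; apply: (nt t).
  by split => //; exact: ltW.
have toy : t_ @ \oo --> +oo%R.
  apply: (@ger_cvgy _ _ _ _ (fun n => n%:R)); last exact: cvgr_idn.
  by apply: nearW => n; rewrite ltW// (lt_trans _ (t_gt n))// ltr_nat.
have [C hC] := growth_bound (@bounded_image_cube R d _ v N cv).
move: Ic; rewrite ltNge => /negP; apply.
(* Reverse Fatou puts c below the integral of the limsup along t_n, which is pointwise at most the
   recession function. *)
apply: (@le_trans _ _ (\int[@lebesgue_tuple R d]_(y in cube N)
    limn_esup (fun n => (h (toTorus (row_of_tuple y))
      (t_ n *: v (row_of_tuple y)) * (t_ n)^-1)%:E))%E); last first.
  apply: le_integral_nonmeasurable => y _.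
  by under eq_fun do rewrite EFinM; exact: limn_esup_le_recession2.
apply: (@le_integral_limn_esup _ _ _ _ _ (fun n y =>
  (h (toTorus (row_of_tuple y)) (t_ n *: v (row_of_tuple y)) * (t_ n)^-1)%:E)
  (fun=> C%:E)).
- exact: measurable_cube.
- move=> n; apply/measurable_EFinP; apply: measurable_funM => //.
  apply: (@continuous_measurable_row_of_tuple R d
    (fun x => h (toTorus x) (t_ n *: v x))).
  by apply: continuous_integrand => x; exact/continuousZl_tmp/cv.
- by apply: (@continuous_cube_integrable R d N (cst C)); exact: cst_continuous.
- move=> n y cy; rewrite lee_fin; apply: hC; first by exists y.
  by rewrite ltW// (le_lt_trans _ (t_gt n))// ler1n.
- exact: t_int.
Qed.

End integrand.

(** * Comparison of the envelopes *)

Lemma A_free_hom_scale_le (R : realType) (d m n k : nat)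
    (A : {ffun 'I_d -> 'I_k.+1} -> {linear 'rV[R]_m -> 'rV[R]_n})
    (h : torus R d -> 'rV[R]_m -> R) N (w : 'rV[R]_d -> 'rV[R]_m)
    (z : 'rV[R]_m) (t : R) :
  continuous (fun p : torus R d * 'rV[R]_m => h p.1 p.2) ->
  (0 < N)%N -> smooth w -> Defs.periodic N w -> (forall x, pdo A w x = 0) ->
  (forall j, (\int[@lebesgue_tuple R d]_(y in cube N)
                 (w (row_of_tuple y) 0 j)%:E = 0)%E) ->
  0 < t ->
  (A_free_hom A (fun xi v => (h xi v)%:E) (t *: z) * (t^-1)%:E <=
   ((N%:R ^+ d)^-1)%:E * \int[@lebesgue_tuple R d]_(y in cube N)
     (h (toTorus (row_of_tuple y)) (t *: (z + w (row_of_tuple y))) * t^-1)%:E)%E.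
Proof.
move=> h_cont N0 sw pw Aw w0 t0.
have cw := smooth_continuous sw.
have ih : (@lebesgue_tuple R d).-integrable (cube N) (fun y =>
    (h (toTorus (row_of_tuple y)) (t *: (z + w (row_of_tuple y))))%:E).
  apply: (@continuous_cube_integrable R d N
    (fun x => h (toTorus x) (t *: (z + w x)))).
  apply: continuous_integrand => // x.
  apply: (@continuousZl_tmp _ _ _ (fun x => z + w x)).
  by apply: continuousD; [exact: cst_continuous|exact: cw].
under eq_integral do rewrite mulrC EFinM.
rewrite integralZl//; last exact: measurable_cube.
(* With the positive factor 1/t removed from both sides, the right side is the mean attained by the
   competitor [t \*: w] at t z. *)
rewrite muleCA muleC; apply: lee_wpmul2l; first by rewrite lee_fin invr_ge0 ltW.
apply: ereal_inf_lbound; exists N, (t \*: w); split => //.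
- by split; [exact: smoothZ|exact: periodicZ].
- by move=> x; rewrite pdoZ//= Aw scaler0.
- move=> j; under eq_integral do rewrite /= mxE EFinM.
  rewrite integralZl; first by rewrite w0 mule0.
  + exact: measurable_cube.
  + apply: (@continuous_cube_integrable R d N (fun x => w x 0 j)) => x.
    apply: (@continuous_comp _ _ _ w (fun M : 'rV[R]_m => M 0 j));
      first exact: cw.
    exact: coord_continuous.
- by congr (_ * _)%E; apply: eq_integral => y _; rewrite scalerDr.
Qed.

Theorem proposition5p7 (R : realType) (d m n k : nat)
    (A : {ffun 'I_d -> 'I_k.+1} -> {linear 'rV[R]_m -> 'rV[R]_n})
    (h : torus R d -> 'rV[R]_m -> R)
    (h_cont : continuous (fun p : torus R d * 'rV[R]_m => h p.1 p.2))
    (h_growth : linear_growth h) :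
  forall z : 'rV[R]_m,
    (A_free_hom A (recession2 (fun xi v => (h xi v)%:E)) z >=
     recession (A_free_hom A (fun xi v => (h xi v)%:E)) z)%E.
Proof.
move=> z; apply: le_ereal_inf_tmp => _ [N [w [N0 [sw pw] Aw w0 ->]]].
have K0 : 0 < (N%:R ^+ d)^-1 :> R by rewrite invr_gt0 exprn_gt0// ltr0n.
(* The mean for w may be infinite, so it is compared with each c above it; the factor N^-d moves to
   the side of c, leaving a strict bound on the integral. *)
apply: lee_forall_gt => c; rewrite -lte_pdivlMl// => Ic.
have cv : continuous (fun x => z + w x).
  move=> x; apply: continuousD; first exact: cst_continuous.
  exact: smooth_continuous.
have near_le := near_integral_le_recession2 h_cont h_growth cv Ic.
apply: limf_esup_le_near; near=> t.
apply: (le_trans (A_free_hom_scale_le z h_cont N0 sw pw Aw w0 _)).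
  by near: t; exact: nbhs_pinfty_gt.
by rewrite -lee_pdivlMl//; near: t.
Unshelve. all: by end_near. Qed.
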